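(* Let $G$ be a group, $\alpha$ an endomorphism of $G$, and $S=BR(G,\alpha)$. Let $N$ be an $\alpha$-invariant normal subgroup of $G$ and $z\in G$ such that $N(z\alpha)=Nz$ and $g^{-1}(Nz)g=Nz$ for all $g\in G$ (that is, $(N,z,0)$ is an admissible triple). Then the group congruence $\varepsilon_{(N,z,0)}$ on $S$ is not perfect. In particular, the minimum group congruence $\sigma_S$ on $S$ is not perfect.
   Context: $\mathbb{N}$ denotes the set of all nonnegative integers. Mappings are written on the right and composed left to right. For a group $G$ and an endomorphism $\alpha$ of $G$, the Bruck–Reilly extension $BR(G,\alpha)$ is the set $\mathbb{N}\times G\times\mathbb{N}$ with multiplication $(m,g,n)(p,h,q)=(m+p-r,\,(g\alpha^{p-r})(h\alpha^{n-r}),\,n+q-r)$, where $r=\min\{n,p\}$ and $\alpha^0$ is the identity automorphism of $G$. It is an inverse semigroup with identity $(0,e_G,0)$ (where $e_G$ is the identity of $G$), with idempotents $(n,e_G,n)$, $n\in\mathbb{N}$, and with inverses $(m,g,n)^{-1}=(n,g^{-1},m)$. For a congruence $\varepsilon$ on a semigroup $S$ and $x\in S$, $x\varepsilon$ denotes the $\varepsilon$-class of $x$. For $A,B\subseteq S$, $AB=\{ab:a\in A,\ b\in B\}$. The congruence $\varepsilon$ is perfect if $(x\varepsilon)(y\varepsilon)=(xy)\varepsilon$ (equality of subsets of $S$) for all $x,y\in S$. It is a group congruence if $S/\varepsilon$ is a group. The minimum group congruence on an inverse semigroup $S$ is $\sigma_S=\{(x,y)\in S\times S: ex=ey\text{ for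 some idempotent }e\in S\}$. A subgroup $N$ of $G$ is $\alpha$-invariant if $N\alpha^{-1}=N$, where $N\alpha^{-1}=\{g\in G: g\alpha\in N\}$. An admissible triple $(N,z,k)$ consists of an $\alpha$-invariant normal subgroup $N$ of $G$, an element $z\in G$, and $k\in\mathbb{N}$ such that $N(z\alpha)=Nz$ and $g^{-1}(Nz)(g\alpha^k)=Nz$ for all $g\in G$. For an admissible triple with $k=0$, put $U(N,z,0)=\{(m,g,m)\in S: g\in N\}$, where $S=BR(G,\alpha)$. Then $\varepsilon_{(N,z,0)}=\{(x,y)\in S\times S: xy^{-1}\in U(N,z,0)\}$, which is known to be a group congruence on $S$ having $U(N,z,0)$ as the identity element of the quotient. *)

(* Defs.v *)
From HB Require Import structures.
From mathcomp Require Import all_boot.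
From mathcomp Require Import boolp classical_sets zify.

Set Implicit Arguments.
Unset Strict Implicit.
Unset Printing Implicit Defensive.

Local Open Scope classical_set_scope.
Local Open Scope group_scope.

Section Congruences.

Variable S : semigroupType.
Implicit Types (eps : S -> S -> Prop) (x y : S).

Definition congruence eps : Prop :=
  [/\ forall x, eps x x,
      forall x y, eps x y -> eps y x,
      forall x y z, eps x y -> eps y z -> eps x z
    & forall x x' y y', eps x x' -> eps y y' -> eps (x * y) (x' * y')].

(* The quotient S/eps is a group, written on representatives. *)
Definition group_congruence eps : Prop :=
  congruence eps /\
  exists u, forall x,
    [/\ eps (u * x) x, eps (x * u) x
      & exists y, eps (x * y) u /\ eps (y * x) u].

Definition cong_class eps x : set S := [set y | eps x y].

Definition set_prod (A B : set S) : set S := [set a * b | a in A & b in B].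

Definition perfect eps : Prop :=
  forall x y,
    set_prod (cong_class eps x) (cong_class eps y) = cong_class eps (x * y).

(* The minimum group congruence when S is an inverse semigroup. *)
Definition sigma x y : Prop :=
  exists e : S, e * e = e /\ e * x = e * y.

End Congruences.
Arguments sigma : clear implicits.

(* UMagmaMorphism.type G G is MathComp's type of endomorphisms of the group G;
   powers alpha^k are written iter k alpha. *)
Section Admissible.

Variables (G : groupType) (alpha : UMagmaMorphism.type G G).

Definition normal_subgroup (N : set G) : Prop :=
  group_closed (mem N) /\ forall g x : G, N x -> N (x ^ g).

Definition invariant (N : set G) : Prop := alpha @^-1` N = N.

Definition right_coset (N : set G) (z : G) : set G := [set x * z | x in N].

Definition admissible (N : set G) (z : G) (k : nat) : Prop :=
  [/\ normal_subgroup N, invariant N, right_coset N (alpha z) = right_coset N z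
    & forall g : G,
        [set g^-1 * x * iter k alpha g | x in right_coset N z] = right_coset N z].

End Admissible.

(* The endomorphism is a phantom parameter: it selects the multiplication. *)
Definition BR (G : groupType) (alpha : UMagmaMorphism.type G G) : Type :=
  (nat * G * nat)%type.

HB.instance Definition _ (G : groupType) (alpha : UMagmaMorphism.type G G) :=
  Choice.copy (BR alpha) (nat * G * nat)%type.

Section BruckReilly.

Variables (G : groupType) (alpha : UMagmaMorphism.type G G).

Definition BR_mul (x y : BR alpha) : BR alpha :=
  let: (m, g, n) := x in
  let: (p, h, q) := y in
  let r := minn n p in
  ((m + p - r)%N, iter (p - r) alpha g * iter (n - r) alpha h, (n + q - r)%N).

Definition BR_one : BR alpha := (0%N, 1, 0%N).

Definition BR_inv (x : BR alpha) : BR alpha :=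
  let: (m, g, n) := x in (n, g^-1, m).

Lemma iter_mulg k (g h : G) :
  iter k alpha (g * h) = iter k alpha g * iter k alpha h.
Proof. by elim: k => //= k ->; rewrite gmulfM. Qed.

Lemma iter_1g k : iter k alpha 1 = 1.
Proof. by elim: k => //= k ->; rewrite gmulf1. Qed.

Lemma iter_invg k (g : G) : iter k alpha g^-1 = (iter k alpha g)^-1.
Proof. by elim: k => //= k ->; rewrite gmulfV. Qed.

Fact BR_mulA : associative BR_mul.
Proof.
move=> [[m g] n] [[p h] q] [[s k] t] /=.
rewrite !iter_mulg -!iterD !mulgA.
congr (_, _ * _ * _, _); try congr (iter _ _ _); lia.
Qed.

Fact BR_mul1 : left_id BR_one BR_mul.
Proof.
by move=> [[m g] n] /=; rewrite min0n !subn0 !add0n iter_1g mul1g.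
Qed.

Fact BR_invK : involutive BR_inv.
Proof. by move=> [[m g] n] /=; rewrite invgK. Qed.

Fact BR_invM : {morph BR_inv : x y / BR_mul x y >-> BR_mul y x}.
Proof.
move=> [[m g] n] [[p h] q] /=.
rewrite invgM -!iter_invg (minnC n p) (addnC m) (addnC n).
congr (_, _, _); lia.
Qed.

End BruckReilly.

HB.instance Definition _ (G : groupType) (alpha : UMagmaMorphism.type G G) :=
  isStarMonoid.Build (BR alpha) (@BR_mulA G alpha) (@BR_mul1 G alpha)
    (@BR_invK G alpha) (@BR_invM G alpha).

Section Epsilon.

Variables (G : groupType) (alpha : UMagmaMorphism.type G G).

Definition U0 (N : set G) : set (BR alpha) :=
  [set ((m, g, m) : BR alpha) | m in [set: nat] & g in N].

(* The group congruence of an admissible triple (N, z, 0): for k = 0 it does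
   not depend on z. *)
Definition epsilon0 (N : set G) (x y : BR alpha) : Prop := U0 N (x * y^-1).

Section EpsilonGroupCongruence.

Variable N : set G.
Hypotheses (nN : normal_subgroup N) (aN : invariant alpha N).

Lemma iter_invariant k u : N (iter k alpha u) = N u.
Proof. by elim: k => //= k <-; rewrite -[in RHS]aN. Qed.

Lemma normal_subgroup1 : N 1.
Proof. by have [[/set_mem]] := nN. Qed.

Lemma normal_subgroupF u v : N u -> N v -> N (u / v).
Proof.
move=> Nu Nv; have [[_ h] _] := nN.
by apply/set_mem/h; apply/mem_set.
Qed.

Lemma normal_subgroupM u v : N u -> N v -> N (u * v).
Proof.
move=> Nu Nv; rewrite -[v]invgK; apply: normal_subgroupF => //.
rewrite -[v^-1]mul1g; apply: normal_subgroupF => //; exact: normal_subgroup1.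
Qed.

Let eqN u v := N (u / v).

Let eqN_sym u v : eqN u v -> eqN v u.
Proof.
move=> uv; rewrite /eqN -invgF -[_^-1]mul1g.
by apply: normal_subgroupF => //; exact: normal_subgroup1.
Qed.

Let eqN_trans v u w : eqN u v -> eqN v w -> eqN u w.
Proof.
move=> uv vw; have := normal_subgroupM uv vw.
by rewrite /eqN mulgA -(mulgA u) mulVg mulg1.
Qed.

Let eqN_mul u u' v v' : eqN u u' -> eqN v v' -> eqN (u * v) (u' * v').
Proof.
move=> uu' vv'; have [_ /(_ u^-1 _ vv')] := nN.
rewrite /conjg invgK => /normal_subgroupM/(_ uu').
by rewrite /eqN invgM !mulgA -(mulgA _ u^-1) mulVg mulg1.
Qed.

Let eqN_iter k u v : eqN (iter k alpha u) (iter k alpha v) <-> eqN u v.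
Proof. by rewrite /eqN -iter_invg -iter_mulg iter_invariant. Qed.

Let epsilon0E (m n p q : nat) (g h : G) :
  epsilon0 N (m, g, n) (p, h, q) <->
  (m + q = n + p)%N /\ eqN (iter q alpha g) (iter n alpha h).
Proof.
have eqE : N (iter (q - minn n q) alpha g * iter (n - minn n q) alpha h^-1) =
    eqN (iter q alpha g) (iter n alpha h).
  rewrite -(iter_invariant (minn n q)) iter_mulg -!iterD iter_invg.
  by congr (N (_ / _)); congr (iter _ _ _); lia.
split.
  case=> k _ [u Nu [mq eu np]]; split; first by lia.
  by rewrite -eqE -eu.
move=> [mn e]; exists (m + q - minn n q)%N => //.
exists (iter (q - minn n q) alpha g * iter (n - minn n q) alpha h^-1).
  by rewrite eqE.
by congr (_, _, _); lia.
Qed.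

Lemma epsilon0_group_congruence : group_congruence (epsilon0 N).
Proof.
split; first split.
- move=> [[m g] n]; apply/epsilon0E; split; first lia.
  by rewrite /eqN mulgV; exact: normal_subgroup1.
- move=> [[m g] n] [[p h] q] /epsilon0E[mq e]; apply/epsilon0E.
  by split; [lia|exact: eqN_sym].
- move=> [[m g] n] [[p h] q] [[s k] t] /epsilon0E[mq e] /epsilon0E[pt f].
  apply/epsilon0E; split; first lia.
  apply/(eqN_iter q); apply: (@eqN_trans (iter (t + n) alpha h)).
    by move/(eqN_iter t): e; rewrite -!iterD addnC.
  by move/(eqN_iter n): f; rewrite -!iterD addnC (addnC n).
- move=> [[m g] n] [[m' g'] n'] [[p h] q] [[p' h'] q'].
  move=> /epsilon0E[mn e] /epsilon0E[pq f]; apply/epsilon0E; split; first lia.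
  apply/(eqN_iter (minn n p + minn n' p')).
  rewrite !iter_mulg -!iterD; apply: eqN_mul.
    move/(eqN_iter (p + q')): e; rewrite -!iterD.
    by congr (eqN (iter _ _ _) (iter _ _ _)); lia.
  move/(eqN_iter (n + n')): f; rewrite -!iterD.
  by congr (eqN (iter _ _ _) (iter _ _ _)); lia.
- exists 1 => x; rewrite mul1g mulg1.
  have xx : epsilon0 N x x.
    case: x => [[m g] n]; apply/epsilon0E; split; first lia.
    by rewrite /eqN mulgV; exact: normal_subgroup1.
  split => //; exists x^-1.
  have inv_r (y : BR alpha) : epsilon0 N (y * y^-1) 1.
    case: y => [[m g] n].
    have -> : ((m, g, n) : BR alpha) * ((m, g, n) : BR alpha)^-1 = (m, 1, m).
      rewrite [LHS]/(BR_mul (m, g, n) (n, g^-1, m)) /= minnn subnn /= mulgV.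
      by congr (_, _, _); lia.
    apply/epsilon0E; split; first lia.
    by rewrite /eqN !iter_1g mulgV; exact: normal_subgroup1.
  by split; first exact: inv_r; have := inv_r x^-1; rewrite invgK.
Qed.

End EpsilonGroupCongruence.

End Epsilon.

(* Main.v *)
Require Import Defs.
From mathcomp Require Import all_boot.
From mathcomp Require Import classical_sets.
From mathcomp Require Import zify.

(** The map (m, g, n) |-> m - n is a homomorphism from the Bruck-Reilly
extension to the integers, called the degree below.  Both congruences of the theorem refine its kernel
and both relate the idempotent (1, 1, 1) to the identity; these two properties
already exclude perfectness ([perfect_degree_contra]).  Indeed, let
x = (1, 1, 0) and x^-1 = (0, 1, 1), so that x * x^-1 = (1, 1, 1) and the class
of x * x^-1 contains the identity (0, 1, 0).  A congruent copy of x has degree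
1, hence first coordinate at least 1, and right multiplication never lowers the
first coordinate.  So the product of the classes of x and x^-1 contains only
elements with a positive first coordinate, and misses the identity. *)

Section DegreePreserving.

Local Open Scope group_scope.

Variables (G : groupType) (alpha : UMagmaMorphism.type G G).
Implicit Types (eps : BR alpha -> BR alpha -> Prop) (x y e : BR alpha).

(** Equality of degrees, with the negative terms moved across because
subtraction truncates on the naturals. *)
Definition same_degree x y : Prop := (x.1.1 + y.2 = x.2 + y.1.1)%N.

Lemma BR_mulE m g n p h q :
  ((m, g, n) : BR alpha) * ((p, h, q) : BR alpha) =
  ((m + p - minn n p)%N,
   iter (p - minn n p) alpha g * iter (n - minn n p) alpha h,
   (n + q - minn n p)%N).
Proof. by []. Qed.

Lemma BR_mul_degree x y z :
  x * y = z -> (z.1.1 + (x.2 + y.2) = z.2 + (x.1.1 + y.1.1))%N.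
Proof.
by case: x y => [[m g] n] [[p h] q] <-; rewrite BR_mulE /=; lia.
Qed.

(** Right multiplication moves down in the R-order, and the first coordinate
indexes the R-classes. *)
Lemma BR_mul_fst_ge x y : (x.1.1 <= (x * y)%g.1.1)%N.
Proof.
case: x y => [[m g] n] [[p h] q].
by rewrite BR_mulE /=; lia.
Qed.

Lemma perfect_degree_contra eps :
  (forall x y, eps x y -> same_degree x y) ->
  eps (1%N, 1, 1%N) 1 -> ~ perfect eps.
Proof.
move=> deg_eps eps1 perf_eps.
have /(congr1 (fun A => A 1)) := perf_eps (1%N, 1, 0%N) (0%N, 1, 1%N).
have -> : ((1%N, 1, 0%N) : BR alpha) * ((0%N, 1, 1%N) : BR alpha)
    = (1%N, 1, 1%N).
  by rewrite BR_mulE /= mulg1.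
move=> prodE.
have [a /deg_eps deg_a [b _ ab1]] :
    set_prod (cong_class eps (1%N, 1, 0%N)) (cong_class eps (0%N, 1, 1%N)) 1.
  by rewrite prodE.
have := BR_mul_fst_ge a b; rewrite ab1.
by move: deg_a; rewrite /same_degree /=; lia.
Qed.

(** Elements of [U0 N] have degree 0, and the degree of x * y^-1 is the difference
of the degrees of x and y. *)
Lemma epsilon0_same_degree (N : set G) x y :
  epsilon0 N x y -> same_degree x y.
Proof.
case: x y => [[m g] n] [[p h] q] [k _ [u _ /esym xyE]].
have := BR_mul_degree (m, g, n) (q, h^-1, p) _ xyE.
by rewrite /same_degree /=; lia.
Qed.

Lemma epsilon0_idempotent_one (N : set G) :
  N 1 -> epsilon0 N ((1%N, 1, 1%N) : BR alpha) 1.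
Proof.
by move=> N1; exists 1%N => //; exists 1 => //; rewrite invg1 mulg1.
Qed.

(** Degrees are additive and the integers are cancellative, so that a common
left factor e can be dropped. *)
Lemma sigma_same_degree x y : sigma (BR alpha) x y -> same_degree x y.
Proof.
case=> e [_]; move ey: (e * y) => w ex.
move: (BR_mul_degree _ _ _ ex) (BR_mul_degree _ _ _ ey).
case: x y e w {ex ey} => [[m g] n] [[p h] q] [[a u] b] [[c v] d].
by rewrite /same_degree /=; lia.
Qed.

Lemma sigma_idempotent_one : sigma (BR alpha) (1%N, 1, 1%N) 1.
Proof.
have idem : ((1%N, 1, 1%N) : BR alpha) * (1%N, 1, 1%N) = (1%N, 1, 1%N).
  by rewrite BR_mulE /= mulg1.
by exists (1%N, 1, 1%N); rewrite mulg1.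
Qed.

End DegreePreserving.

Theorem proposition4p8 (G : groupType) (alpha : UMagmaMorphism.type G G) :
  (forall (N : set G) (z : G), admissible alpha N z 0 ->
     ~ perfect (@epsilon0 G alpha N)) /\
  ~ perfect (sigma (BR alpha)).
Proof.
split=> [N z [nN _ _ _]|]; apply: perfect_degree_contra.
- exact: epsilon0_same_degree.
- by apply: epsilon0_idempotent_one; exact: normal_subgroup1.
- exact: sigma_same_degree.
- exact: sigma_idempotent_one.
Qed.
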